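(* There is an absolute constant $C>0$ such that, for every sufficiently large integer $n$, there is a finite set $$S\subseteq \{1\}\times\{1,\ldots,(n+1)^3\}\subseteq\mathbb{Z}^2$$ with $$|S|\le \frac{5}{2}\log_2\log_2 n+C$$ and an $S$-walk of $n$ steps whose vertices are distinct and contain no three collinear points.
   Context: For a finite set $S\subseteq\mathbb{Z}^2$, an $S$-walk is a sequence of points of $\mathbb{Z}^2$ whose successive differences belong to $S$; an $S$-walk of $n$ steps is such a sequence $Q_0,Q_1,\ldots,Q_n$ with $Q_t-Q_{t-1}\in S$ for $1\le t\le n$. Its vertices are the points $Q_0,\ldots,Q_n$. *)

(* Defs.v *)
From HB Require Import structures.
From mathcomp Require Import all_boot all_order all_algebra finmap.
From mathcomp Require Import reals exp.

Set Implicit Arguments.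
Unset Strict Implicit.
Unset Printing Implicit Defensive.

Import Order.TTheory GRing.Theory Num.Theory.

Local Open Scope ring_scope.

Notation point := (int * int)%type.

Definition log2 (R : realType) (x : R) : R := ln x / ln 2.

(* An S-walk of n steps is an S-walk Q with [size Q = n.+1]; its vertices are
   the members of Q. *)
Definition is_walk (S : {fset point}) (Q : seq point) : bool :=
  sorted [rel p q : point | q - p \in S] Q.

(* The three lattice points lie on the line [a x + b y = c] of R^2. *)
Definition collinear (R : realType) (p q r : point) : Prop :=
  exists a b c : R, (a, b) <> (0, 0) /\
    forall u : point, u \in [:: p; q; r] -> a * u.1%:~R + b * u.2%:~R = c.

Definition no_three_collinear (R : realType) (Q : seq point) : Prop :=
  forall p q r : point, p \in Q -> q \in Q -> r \in Q ->
    p != q -> p != r -> q != r -> ~ collinear R p q r.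

(* Main.v *)
Require Import Defs.
From HB Require Import structures.
From mathcomp Require Import all_boot all_order all_algebra finmap.
From mathcomp Require Import reals exp.
From mathcomp Require Import zify ring lra.

(** The walk is read off an infinite word [word] over the natural numbers: step
t is (1, f (word t)) for positive integer weights f, so the vertices are the
points (t, height f t).  Vertices p < q < r are collinear exactly when the
height h satisfies (r - q) h(p) + (q - p) h(r) = (r - p) h(q).  This relation,
[balanced], is linear in h, and h is the combination, with coefficients f, of
the functions counting the occurrences of each letter.

The word is built so that no triple p < q < r is balanced for all letter counts
at once ([heights_unbalanced]), that is, no two adjacent factors have the same
letter frequencies.  Each triple is then spoiled by some letter, and weights
bounded by (n+1)^3 can be chosen, one letter at a time, that unbalance the fewer
than (n+1)^3 triples simultaneously ([generic_weights]).

The word has a hierarchy of blocks; a block of level i+1 consists of [fanout i]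
blocks of level i, and [fanout i] is the proportion 2^-(i+2) of the length of
these.  Lengths therefore roughly square from one level to the next, and n
letters involve about log2 (log2 n) levels.  Each level costs two letters.
- A separator ends every block.  Separators count completed blocks, so in a
  balanced triple the number of completed blocks is balanced at every level, and
  so are the residue of the position in its block and the digit that tells which
  subblock it lies in.
- A mark.  Every block of level i has [fanout i] places for marks of level i,
  and in the d-th subblock of a block of level i+1 the last d of them are
  filled.  Among positions in a block of level i+1 with a given residue at level
  i, the number of these marks before the position is a strictly convex function
  of the digit d ([window_increasing]), so it is not balanced on a balanced
  triple of digits unless the digits are equal.
By induction on the level the three positions agree modulo every block length
([residue0_constant], [residueS_constant]), so they are equal.  The total is two
letters per level and a constant number of others, hence at most
2 log2 (log2 n) + 18, which lies below the required bound. *)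

Set Implicit Arguments.
Unset Strict Implicit.
Unset Printing Implicit Defensive.

Import Order.TTheory GRing.Theory Num.Theory.

Local Open Scope nat_scope.

(** * Balanced triples *)

(** For l = r - q and k = q - p this says that F agrees with an affine function
at p, q and r. *)
Definition balanced (l k p q r : nat) (F : nat -> nat) : Prop :=
  l * F p + k * F r = (l + k) * F q.

Lemma balanced_sub l k p q r F G H : (forall t, F t = G t + H t) ->
  balanced l k p q r F -> balanced l k p q r G -> balanced l k p q r H.
Proof. rewrite /balanced => FE; rewrite !FE; nia. Qed.

Lemma balancedMl c l k p q r F :
  balanced l k p q r F -> balanced l k p q r (fun t => c * F t).
Proof. rewrite /balanced; nia. Qed.

Lemma balanced_steps p q r : p < q < r -> balanced (r - q) (q - p) p q r id.
Proof. rewrite /balanced; nia. Qed.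

(** F q is a weighted mean of F p and F r with positive weights. *)
Lemma balanced_trichotomy l k p q r F : 0 < l -> 0 < k ->
  balanced l k p q r F ->
  [\/ F p = F q /\ F q = F r, F p < F q < F r | F r < F q < F p].
Proof.
rewrite /balanced => l0 k0 E.
case: (ltngtP (F p) (F q)) => pq.
- by apply: Or32; nia.
- by apply: Or33; nia.
- apply: Or31; nia.
Qed.

(** A strictly convex sequence lies on or above the line through its values at v
and v.+1, and strictly above it to the left of v, so its weighted mean over u
and w exceeds its value at the mean v.  Only a finite range is convex, whence
the bound K. *)
Lemma convex_not_balanced (K l k u v w : nat) (Psi delta : nat -> nat) :
    (forall d, d.+1 < K -> Psi d.+1 = Psi d + delta d) ->
    (forall d, d.+2 < K -> delta d < delta d.+1) ->
    0 < l -> u < v < w -> w < K -> l * u + k * w = (l + k) * v ->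
  l * Psi u + k * Psi w <> (l + k) * Psi v.
Proof.
move=> PsiS deltaS l0 /andP[uv vw] wK E.
have delta_incr d m : (d + m).+1 < K -> delta d + m <= delta (d + m).
  elim: m => [|m IH] dmK; first by rewrite !addn0.
  have := deltaS (d + m); rewrite addnS in dmK *.
  by have := IH ltac:(lia); lia.
have above m : v + m < K -> Psi v + m * delta v <= Psi (v + m).
  elim: m => [|m IH] vmK; first by rewrite mul0n !addn0.
  rewrite addnS in vmK *; rewrite PsiS //.
  by have := IH ltac:(lia); have := delta_incr v m vmK; lia.
have below m x : x + m < v ->
    Psi (x + m).+1 < Psi x + m.+1 * delta (x + m).+1.
  elim: m x => [|m IH] x xmv.
    by rewrite addn0 in xmv *; have := deltaS x; rewrite PsiS; lia.
  have := IH x.+1 ltac:(lia); rewrite (PsiS x); last lia.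
  have := delta_incr x m.+2 ltac:(lia).
  rewrite !addnS !addSn [m.+2 * _]mulSn; lia.
have Pw : Psi v + (w - v) * delta v <= Psi w.
  by have := above (w - v); rewrite subnKC ?(ltnW vw) //; apply.
have Pu : Psi v < Psi u + (v - u) * delta v.
  have := below (v - u).-1 u; rewrite -addnS prednK ?subn_gt0 //.
  by rewrite subnKC ?(ltnW uv) //; apply; lia.
have Evw : l * (v - u) = k * (w - v) by nia.
by nia.
Qed.

(** * The word *)

Definition cell_len i := 2 ^ i.+2.
Definition fanout i := 2 ^ (2 ^ i).+1.
Definition block_len i := fanout i * cell_len i.

(** The middle of a cell is the place for a mark.  Filling the last cells of a
block, rather than the first ones, is what makes the number of marks before a
position strictly convex in the index of the block for every residue inside the
block: an early cell gains its mark late. *)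
Definition marked i t : bool :=
  (t %% cell_len i == 2 ^ i.+1) &&
  (fanout i <= t %% block_len i %/ cell_len i + t %/ block_len i %% fanout i).

(** For t a multiple of 16, the highest level of a block ending just before
position t. *)
Definition block_level t := \max_(j < t | block_len j %| t) j.

(** The codes 16 + 2 j are separators, ending the blocks of length 16 of level 0
and, when j > 0, larger ones; 17 + 2 i is a mark of level i and 0 a blank.  The
odd letters below 15 distinguish the positions inside a block of level 0.  The
2-adic valuation of t > 0 tells for which level, if any, the position t can hold
a mark, so the places for different levels never clash. *)
Definition word t : nat :=
  if odd t then
    if t %% 16 == 15 then 16 + (block_level t.+1).*2 else t %% 16
  else let i := (logn 2 t).-1 in if marked i t then 17 + i.*2 else 0.

Lemma cell_gt0 i : 0 < cell_len i. Proof. exact: expn_gt0. Qed.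
Lemma fanout_gt0 i : 0 < fanout i. Proof. exact: expn_gt0. Qed.
Lemma block_gt0 i : 0 < block_len i.
Proof. by rewrite muln_gt0 fanout_gt0 cell_gt0. Qed.

Lemma block_lenS i : block_len i.+1 = fanout i * block_len i.
Proof.
rewrite /block_len /fanout /cell_len -!expnD; congr (2 ^ _).
by rewrite (expnS 2 i); lia.
Qed.

Lemma dvdn_block i j : i <= j -> block_len i %| block_len j.
Proof.
move=> /subnKC <-; elim: (j - i) => [|m IH]; first by rewrite addn0.
by rewrite addnS block_lenS dvdn_mull.
Qed.

Lemma ltn_block i : i < block_len i.
Proof.
have: i < 2 ^ i by rewrite ltn_expl.
have := fanout_gt0 i; rewrite /block_len /cell_len !expnS; nia.
Qed.

Lemma leq_block_level j t : 0 < t -> 16 %| t ->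
  (j <= block_level t) = (block_len j %| t).
Proof.
move=> t0 t16; apply/idP/idP => [jt|dt].
  have t_ok : 0 < #|[pred i : 'I_t | block_len i %| t]|.
    by apply/card_gt0P; exists (Ordinal t0).
  have [i it levelE] := eq_bigmax_cond (fun i : 'I_t => i : nat) t_ok.
  by apply: dvdn_trans (dvdn_block _) it; rewrite -levelE.
have jlt : j < t by apply: leq_trans (ltn_block j) (dvdn_leq t0 dt).
by apply: (leq_bigmax_cond (Ordinal jlt)).
Qed.

Lemma word_odd_letter o t : odd o -> o < 15 -> (word t == o) = (t %% 16 == o).
Proof.
move=> odd_o o15; rewrite /word.
have t16 : odd (t %% 16) = odd t by rewrite odd_mod.
case: (boolP (odd t)) => odd_t.
  case: (t %% 16 =P 15) => [->|//].
  by rewrite gtn_eqF ?gtn_eqF //; lia.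
have -> : (t %% 16 == o) = false.
  by apply/eqP => E; rewrite E odd_o in t16; rewrite -t16 in odd_t.
by case: ifP => _; apply/eqP => E; move: odd_o o15; rewrite -?E //; lia.
Qed.

(** A boundary of level j is also one of every lower level, so a position before
such a boundary carries a separator of level at least j. *)
Lemma word_separator j t :
  (16 + j.*2 <= word t) && ~~ odd (word t) = (block_len j %| t.+1).
Proof.
have block16 : 16 %| block_len j by apply: (@dvdn_block 0).
rewrite /word; case: (boolP (odd t)) => odd_t.
  case: (t %% 16 =P 15) => t15.
    have t16 : 16 %| t.+1 by apply/eqP; lia.
    by rewrite -leq_block_level // oddD odd_double andbT leq_add2l leq_double.
  have -> : (block_len j %| t.+1) = false.
    by apply: contra_notF t15 => /(dvdn_trans block16); lia.
  by apply/negbTE; lia.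
have -> : (block_len j %| t.+1) = false.
  by apply: contraNF odd_t => /(dvdn_trans block16); lia.
by case: ifP => _; apply/negbTE; lia.
Qed.

Lemma marked_logn i t : marked i t -> logn 2 t = i.+1.
Proof.
case/andP=> /eqP tE _; rewrite (divn_eq t (cell_len i)) tE /cell_len.
have -> : t %/ 2 ^ i.+2 * 2 ^ i.+2 + 2 ^ i.+1 =
    2 ^ i.+1 * (t %/ 2 ^ i.+2).*2.+1.
  by rewrite (expnS _ i.+1); lia.
rewrite lognM ?expn_gt0 // pfactorK //.
by rewrite [X in _ + X]lognE /= dvdn2 /= odd_double addn0.
Qed.

Lemma marked_even i t : marked i t -> ~~ odd t.
Proof.
move=> mt; have := marked_logn mt.
by rewrite lognE -dvdn2; case: (2 %| t); rewrite // andbF.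
Qed.

Lemma word_marked i t : (word t == 17 + i.*2) = marked i t.
Proof.
rewrite /word; case: (boolP (odd t)) => odd_t.
  have -> : marked i t = false by apply: contraTF odd_t => /marked_even.
  by case: ifP => _; apply/eqP; lia.
case: (boolP (marked _ t)) => [mt|nmt].
  apply/eqP/idP => [E|/marked_logn ->]; last by [].
  by have <- : (logn 2 t).-1 = i by lia.
apply/esym/negbTE; apply: contra nmt => mt.
by rewrite (marked_logn mt).
Qed.

(** * Counting letters *)

Lemma sum_nat_shift (g : nat -> nat) m n :
  \sum_(0 <= s < m + n) g s =
    \sum_(0 <= s < m) g s + \sum_(0 <= s < n) g (m + s).
Proof.
rewrite (@big_cat_nat _ _ _ m) ?leq_addr //= -{2}[m]add0n big_addn addKn.
by congr (_ + _); apply: eq_bigr => s _; rewrite addnC.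
Qed.

Lemma sum_periodic (g : nat -> nat) N t :
    0 < N -> (forall s, g (N + s) = g s) ->
  \sum_(0 <= s < t) g s =
    t %/ N * \sum_(0 <= s < N) g s + \sum_(0 <= s < t %% N) g s.
Proof.
move=> N0 gN; rewrite {1}(divn_eq t N).
elim: (t %/ N) => [|d IH]; first by rewrite !mul0n.
rewrite !mulSn -addnA sum_nat_shift -addnA; congr (_ + _).
by rewrite -IH; apply: eq_bigr.
Qed.

Lemma sum_dvdn N t : 0 < N -> \sum_(0 <= s < t) (N %| s.+1 : nat) = t %/ N.
Proof.
move=> N0; elim: t => [|t IH]; first by rewrite big_nil div0n.
by rewrite big_nat_recr //= IH divnS // addnC.
Qed.

Lemma sum_pred1 o n : \sum_(0 <= s < n) (s == o : nat) = (o < n).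
Proof.
elim: n => [|n IH]; first by rewrite big_nil.
by rewrite big_nat_recr //= IH; lia.
Qed.

Lemma marked_periodic i s : marked i (block_len i.+1 + s) = marked i s.
Proof.
have cE : block_len i.+1 = fanout i * fanout i * cell_len i.
  by rewrite block_lenS mulnA.
rewrite /marked {1}cE modnMDl block_lenS modnMDl divnMDl ?block_gt0 //.
by rewrite modnDl.
Qed.

Lemma markedE i d o : d < fanout i -> o < block_len i ->
  marked i (d * block_len i + o) =
    (o %% cell_len i == 2 ^ i.+1) && (fanout i <= o %/ cell_len i + d).
Proof.
move=> dK oN; rewrite /marked modnMDl divnMDl ?block_gt0 //.
rewrite (modn_small oN) (divn_small oN) addn0 (modn_small dK).
by rewrite {1}/block_len mulnA modnMDl.
Qed.

(** The increment of the number of marks when the digit goes from d to d.+1 at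
residue x: offsets before x are met in the next block already. *)
Definition window i x d :=
  \sum_(0 <= o < block_len i)
     (marked i ((d + (o < x)) * block_len i + o) : nat).

Lemma marked_window i x d : x <= block_len i ->
  \sum_(0 <= s < d.+1 * block_len i + x) (marked i s : nat) =
  \sum_(0 <= s < d * block_len i + x) (marked i s : nat) + window i x d.
Proof.
move=> xN; rewrite mulSn [block_len i + _]addnC.
have -> : d * block_len i + block_len i + x =
  d * block_len i + (x + (block_len i - x) + x) by lia.
rewrite !sum_nat_shift -!addnA; congr (_ + (_ + _)).
rewrite /window -[X in _ = \sum_(0 <= o < X) _](subnKC xN) sum_nat_shift addnC.
congr (_ + _).
  rewrite !big_nat; apply: eq_bigr => o /andP[_ ox].
  by rewrite ox; congr (nat_of_bool (marked _ _)); lia.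
rewrite !big_nat; apply: eq_bigr => o /andP[_ ox].
by rewrite ltnNge leq_addr; congr (nat_of_bool (marked _ _)); lia.
Qed.

(** Passing from one block to the next keeps every mark and adds one, in the
cell just before the marked ones.  So no offset of the window loses its mark,
and some offset gains one: either the new mark of block d.+1 is at an offset at
least x, or the still earlier new mark of block d.+2 is at an offset below x. *)
Lemma window_increasing i x d : d.+2 < fanout i ->
  window i x d < window i x d.+1.
Proof.
move=> dK; set K := fanout i in dK *.
have mono o : o < block_len i ->
    marked i ((d + (o < x)) * block_len i + o) <=
    marked i ((d.+1 + (o < x)) * block_len i + o).
  move=> oN; rewrite !markedE //; [|case: (o < x); lia..].
  by case: (_ == _) => //=; lia.
have c0 := cell_gt0 i.
have c2 : 2 ^ i.+1 < cell_len i by rewrite ltn_exp2l.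
(* the place for a mark in cell j *)
pose f j := j * cell_len i + 2 ^ i.+1.
have fdiv j : f j %/ cell_len i = j by rewrite divnMDl // divn_small // addn0.
have fmod j : f j %% cell_len i = 2 ^ i.+1 by rewrite modnMDl modn_small.
have fN j : j < K -> f j < block_len i.
  move=> jK; rewrite /block_len -/K /f; nia.
have [o oN strict] : exists2 o, o < block_len i &
    marked i ((d + (o < x)) * block_len i + o) <
    marked i ((d.+1 + (o < x)) * block_len i + o).
  case: (leqP x (f (K - d.+1))) => xf.
    exists (f (K - d.+1)); first by apply: fN; lia.
    rewrite (leq_gtF xf) !addn0 !markedE ?fN ?fdiv ?fmod ?eqxx //=; lia.
  have ff : f (K - d.+2) < x by apply: leq_trans xf; rewrite /f; nia.
  exists (f (K - d.+2)); first by apply: fN; lia.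
  rewrite ff !addn1 !markedE ?fN ?fdiv ?fmod ?eqxx //=; lia.
rewrite /window !big_mkord (bigD1 (Ordinal oN)) //=.
rewrite [ltnRHS](bigD1 (Ordinal oN)) //=.
rewrite -addSn; apply: leq_add => //; apply: leq_sum => o' _; exact: mono.
Qed.

(** * No triple is balanced for all letters *)

Definition height (f : nat -> nat) (t : nat) := \sum_(0 <= s < t) f (word s).

Lemma balanced_ext l k p q r F G : F =1 G ->
  balanced l k p q r F -> balanced l k p q r G.
Proof. by move=> FG; rewrite /balanced !FG. Qed.

Lemma balanced_block l k p q r :
  (forall f, balanced l k p q r (height f)) ->
  forall i, balanced l k p q r (divn^~ (block_len i)).
Proof.
move=> H i.
apply: balanced_ext (H (fun c => (16 + i.*2 <= c) && ~~ odd c)) => t.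
rewrite -(sum_dvdn _ (block_gt0 i)); apply: eq_bigr => s _.
by rewrite word_separator.
Qed.

(** If the residues differ, they are strictly monotone, so two or more adjacent
positions of the block of length 16 separate the outer two.  One of them is odd
and carries a letter of its own.  Up to the number of complete blocks, the count
of that letter is the indicator of having passed it, which is 0 at one end and 1
at the other, and no value in {0, 1} at the middle is their weighted mean. *)
Lemma residue0_constant l k p q r : 0 < l -> 0 < k ->
    balanced l k p q r id -> (forall f, balanced l k p q r (height f)) ->
  p %% block_len 0 = q %% block_len 0 /\ q %% block_len 0 = r %% block_len 0.
Proof.
move=> l0 k0 B_id H; have BD := balanced_block H 0.
rewrite -[block_len 0]/16 in BD *.
have Bmod : balanced l k p q r (modn^~ 16).
  by apply: balanced_sub B_id (balancedMl 16 BD) => t; rewrite mulnC -divn_eq.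
have Bind o : odd o -> o < 15 -> balanced l k p q r (fun t => o < t %% 16).
  move=> odd_o o15.
  apply: balanced_sub (H (fun c => c == o)) BD => t.
  rewrite /height (@sum_periodic _ 16) //; last first.
    by move=> s; rewrite !word_odd_letter // modnDl.
  congr (_ + _).
    rewrite -[RHS]muln1; congr (_ * _).
    under eq_big_nat => s /andP[_ s16] do
      rewrite word_odd_letter // modn_small //.
    by rewrite sum_pred1; lia.
  under eq_big_nat => s /andP[_ s16].
    rewrite word_odd_letter // (@modn_small s); last by lia.
    over.
  by rewrite sum_pred1.
(* every interval of two or more offsets contains an odd one *)
have no_rise a b : a < b -> b < 16 ->
    (forall o, odd o -> o < 15 -> ~ (a <= o < b)) -> b = a.+1 /\ ~~ odd a.
  move=> ab b16 no; case: (boolP (odd a)) => oa.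
    by case: (no a oa); lia.
  split=> //; apply/eqP; rewrite eqn_leq ab andbT leqNgt; apply/negP => a1b.
  by case: (no a.+1); rewrite /= ?oa; lia.
have mod16 t : t %% 16 < 16 by rewrite ltn_mod.
have sep a b o : balanced l k p q r (fun t => o < t %% 16) ->
   (a = p /\ b = r) \/ (a = r /\ b = p) ->
   a %% 16 <= o < b %% 16 -> False.
  rewrite /balanced => + ab; case: ab => [[-> ->]|[-> ->]] E /andP[ao ob].
    move: E; rewrite ob ltnNge ao /=; case: (o < q %% 16); nia.
  move: E; rewrite ob ltnNge ao /=; case: (o < q %% 16); nia.
case: (balanced_trichotomy l0 k0 Bmod) => // lt3; exfalso.
  have [] := @no_rise (p %% 16) (r %% 16); [lia|by []| |lia].
  by move=> o oo o15; apply: sep (Bind o oo o15) _; left.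
have [] := @no_rise (r %% 16) (p %% 16); [lia|by []| |lia].
by move=> o oo o15; apply: sep (Bind o oo o15) _; right.
Qed.

Definition digit i t := t %/ block_len i %% fanout i.

Lemma ltn_digit i t : digit i t < fanout i.
Proof. by rewrite ltn_mod fanout_gt0. Qed.

Lemma divn_blockE i t :
  t %/ block_len i = fanout i * (t %/ block_len i.+1) + digit i t.
Proof.
rewrite block_lenS (mulnC (fanout i) (block_len i)) divnMA mulnC.
exact: divn_eq.
Qed.

Lemma modn_blockS i t :
  t %% block_len i.+1 = digit i t * block_len i + t %% block_len i.
Proof.
have tE := divn_eq t (block_len i); rewrite divn_blockE in tE.
have tSE := divn_eq t (block_len i.+1).
by rewrite block_lenS in tE tSE *; nia.
Qed.

Lemma balanced_digit l k p q r i : (forall f, balanced l k p q r (height f)) ->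
  balanced l k p q r (digit i).
Proof.
move=> H; apply: balanced_sub (balancedMl (fanout i) (balanced_block H i.+1)).
  exact: divn_blockE.
exact: balanced_block.
Qed.

Lemma balanced_marked l k p q r i : (forall f, balanced l k p q r (height f)) ->
  balanced l k p q r
    (fun t => \sum_(0 <= s < t %% block_len i.+1) (marked i s : nat)).
Proof.
move=> H; pose c := \sum_(0 <= s < block_len i.+1) (marked i s : nat).
apply: balanced_sub (balancedMl c (balanced_block H i.+1)); last first.
  exact: (H (fun a => a == 17 + i.*2)).
move=> t; rewrite mulnC -sum_periodic ?block_gt0 //; last first.
  by move=> s; rewrite marked_periodic.
by apply: eq_bigr => s _; rewrite word_marked.
Qed.

(** With equal residues at level i, the residues at level i+1 differ only in the
digit, of which the number of marks of level i is a strictly convex function. *)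
Lemma residueS_constant l k p q r i : 0 < l -> 0 < k ->
    (forall f, balanced l k p q r (height f)) ->
    p %% block_len i = q %% block_len i ->
    q %% block_len i = r %% block_len i ->
  p %% block_len i.+1 = q %% block_len i.+1 /\
  q %% block_len i.+1 = r %% block_len i.+1.
Proof.
move=> l0 k0 H pq qr.
have Bd := balanced_digit i H.
have := balanced_marked i H; rewrite /balanced !modn_blockS -qr pq.
set x := q %% _.
have xN : x <= block_len i by rewrite ltnW // ltn_mod block_gt0.
pose Psi e := \sum_(0 <= s < e * block_len i + x) (marked i s : nat).
rewrite -!/(Psi _) => BPsi.
have PsiS e : e.+1 < fanout i -> Psi e.+1 = Psi e + window i x e.
  by move=> _; apply: marked_window.
have cvx := convex_not_balanced PsiS (@window_increasing i x).
case: (balanced_trichotomy l0 k0 Bd) => [[-> ->]//|lt3|lt3]; exfalso.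
  exact: (cvx _ _ _ _ _ l0 lt3 (ltn_digit i r) Bd BPsi).
apply: (cvx _ _ _ _ _ k0 lt3 (ltn_digit i p)).
  by rewrite addnC (addnC k); exact: Bd.
by rewrite addnC (addnC k); exact: BPsi.
Qed.

Lemma heights_unbalanced p q r : p < q < r ->
  ~ (forall f, balanced (r - q) (q - p) p q r (height f)).
Proof.
move=> pqr H; have Bid := balanced_steps pqr.
have l0 : 0 < r - q by lia.
have k0 : 0 < q - p by lia.
have const i : p %% block_len i = q %% block_len i /\
    q %% block_len i = r %% block_len i.
  elim: i => [|i [pq qr]]; first exact: residue0_constant Bid H.
  exact: residueS_constant H pq qr.
have [pq _] := const q; have qq := ltn_block q.
by move: pq; rewrite !modn_small //; lia.
Qed.

(** * Weights *)

(** The weights are chosen one letter at a time.  A form whose coefficient at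
the last letter vanishes is taken care of by the earlier weights; any other form
forbids at most one value of the last weight, and there are fewer forms than
values. *)
Lemma generic_weights (T : eqType) (ts : seq T) (c : T -> nat -> int) m M :
    size ts < M -> (forall x, x \in ts -> exists2 a, a < m & c x a != 0%R) ->
  exists f : nat -> nat, (forall a, 0 < f a <= M) /\
    forall x, x \in ts -> (\sum_(0 <= a < m) c x a * (f a)%:Z != 0)%R.
Proof.
elim: m ts => [|m IH] ts tsM nz.
  exists (fun=> 1); split=> [a|x /nz[a]//]; lia.
pose old x := has (fun a => c x a != 0%R) (iota 0 m).
have [||f [fM f_old]] := IH (filter old ts).
- by apply: leq_ltn_trans tsM; rewrite size_filter count_size.
- move=> x; rewrite mem_filter => /andP[/hasP[a + nza] _].
  by rewrite mem_iota => am; exists a.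
pose partial x := (\sum_(0 <= a < m) c x a * (f a)%:Z)%R.
pose forbidden x := `|partial x| %/ `|c x m|.
have [v /andP[v0 vM] v_ok] :
    exists2 v, 0 < v <= M & v \notin map forbidden ts.
  have : ~~ all (mem (map forbidden ts)) (iota 1 M).
    apply: contraTN tsM => /allP sub; rewrite -leqNgt.
    rewrite -(size_map forbidden) -{1}(size_iota 1 M).
    by apply: uniq_leq_size sub; apply: iota_uniq.
  case/allPn=> v; rewrite mem_iota => vM nv; exists v => //; lia.
exists (fun a => if a == m then v else f a); split=> [a|x xts].
  by case: eqP => _; rewrite ?fM ?v0.
rewrite big_nat_recr //= eqxx.
have -> : (\sum_(0 <= a < m) c x a * (if a == m then v else f a)%:Z)%R =
    partial x.
  by apply: eq_big_nat => a /andP[_ am]; rewrite (ltn_eqF am).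
case: (eqVneq (c x m) 0%R) => [cm|cm].
  rewrite cm mul0r addr0; apply: f_old; rewrite mem_filter xts andbT.
  have [a am ca] := nz x xts; apply/hasP; exists a => //.
  rewrite mem_iota add0n; move: am; rewrite ltnS leq_eqVlt => /orP[/eqP aE|//].
  by rewrite aE cm eqxx in ca.
apply: contraNneq v_ok => sum0; apply/mapP; exists x => //.
have px : partial x = (- (c x m * v%:Z))%R.
  by apply/eqP; rewrite -addr_eq0 sum0.
by rewrite /forbidden px abszN abszM absz_nat mulKn // absz_gt0.
Qed.

Lemma height_letters f m t : (forall s, s < t -> word s < m) ->
  height f t = \sum_(0 <= a < m) f a * height (fun b => b == a) t.
Proof.
move=> wm; under [RHS]eq_bigr => a _ do rewrite /height big_distrr /=.
rewrite exchange_big /=; apply: eq_big_nat => s /andP[_ /wm wsm].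
rewrite big_mkord (bigD1 (Ordinal wsm)) //= eqxx muln1 big1 ?addn0 // => a ane.
by rewrite eq_sym (_ : (a : nat) == word s = false) ?muln0 //; apply/negbTE.
Qed.

(** A separator or a mark of level i among the first n letters needs a complete
block of level i, of length more than 2^(2^i). *)
Lemma word_bound n t : t < n -> word t < 18 + (trunc_log 2 (trunc_log 2 n)).*2.
Proof.
move=> tn.
have level_le i : block_len i <= n -> i <= trunc_log 2 (trunc_log 2 n).
  move=> iN; do 2 apply: trunc_log_max => //.
  apply: leq_trans iN; rewrite /block_len /fanout /cell_len -expnD.
  by rewrite leq_exp2l //; lia.
rewrite /word; case: (odd t).
  case: (t %% 16 =P 15) => t15; last by have := ltn_mod t 16; lia.
  have t16 : 16 %| t.+1 by apply/eqP; lia.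
  have : block_len (block_level t.+1) %| t.+1 by rewrite -leq_block_level.
  move/dvdn_leq => /(_ isT) bt.
  by have := level_le _ (leq_trans bt tn); lia.
case: ifP => [|_]; last by lia.
set i := _.-1 => /andP[_ mt].
have: block_len i <= n; last by move/level_le; lia.
apply: leq_trans (ltnW tn); rewrite leqNgt; apply: contraL mt => ti.
rewrite (divn_small ti) mod0n addn0 (modn_small ti) -ltnNge.
by rewrite ltn_divLR ?cell_gt0.
Qed.

Lemma generic_heights n m : (forall t, t < n -> word t < m) ->
  exists f : nat -> nat, (forall a, 0 < f a <= n.+1 ^ 3) /\
    forall p q r, p < q < r -> r <= n ->
      ~ balanced (r - q) (q - p) p q r (height f).
Proof.
move=> wm.
pose defect (F : nat -> nat) (x : nat * nat * nat) : int :=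
  let: (p, q, r) := x in
  (((r - q) * F p + (q - p) * F r)%:Z - ((r - q + (q - p)) * F q)%:Z)%R.
have defectE F p q r :
    balanced (r - q) (q - p) p q r F <-> defect F (p, q, r) = 0%R.
  by rewrite /balanced /defect; split; lia.
(* r > 0 leaves n choices for r, which makes the count strictly below (n+1)^3 *)
pose triples :=
  [seq x <- [seq (pq, r)
               | pq <- [seq (p, q) | p <- iota 0 n.+1, q <- iota 0 n.+1],
                 r <- iota 1 n]
     | x.1.1 < x.1.2 < x.2].
have triplesP p q r : (p, q, r) \in triples = (p < q < r) && (r <= n).
  rewrite mem_filter; apply/andP/andP => [[pqr]|[pqr rn]].
    by case/allpairsP=> -[pq r'] [_ + [_ rE]]; rewrite mem_iota /= in rE *;
      split=> //; lia.
  split=> //.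
  apply: allpairs_f; last by rewrite mem_iota; lia.
  by apply: allpairs_f; rewrite mem_iota; lia.
have few : size triples < n.+1 ^ 3.
  rewrite size_filter (leq_ltn_trans (count_size _ _)) //.
  rewrite !size_allpairs !size_iota.
  by rewrite !expnS expn0; nia.
have [|f [fM f_ok]] := @generic_weights _ triples
  (fun x a => defect (height (fun b => b == a)) x) m _ few.
  move=> [[p q] r]; rewrite triplesP => /andP[pqr' rn].
  have : [exists a : 'I_m,
      defect (height (fun b => b == a)) (p, q, r) != 0%R].
    apply: contra_notT (heights_unbalanced pqr') => /existsPn none f.
    rewrite /balanced !(@height_letters f m);
      try by move=> s st; apply: wm; lia.
    rewrite !big_distrr -big_split /=; apply: eq_big_nat => a /andP[_ am].
    have /negPn/eqP/defectE := none (Ordinal am).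
    by rewrite /balanced /= => E; nia.
  by case/existsP=> a na; exists a.
exists f; split=> // p q r pqr rn /defectE E.
have pqr_in : (p, q, r) \in triples by rewrite triplesP; lia.
have /eqP[] := f_ok _ pqr_in; rewrite -[RHS]E /defect.
have hE t : t <= n -> ((height f t)%:Z =
    \sum_(0 <= a < m) (f a * height (fun b => b == a) t)%N%:Z)%R.
  move=> tn; rewrite (@height_letters f m) ?(big_morph Posz PoszD erefl) //.
  by move=> s st; apply: wm; lia.
rewrite PoszD !PoszM !hE; try lia.
rewrite !big_distrr -big_split -sumrB; apply: eq_bigr => a _ /=.
by rewrite !PoszD !PoszM; ring.
Qed.

(** * The walk *)

Local Open Scope ring_scope.

Lemma line_balanced (R : realType) (a b c : R) (Y : nat -> nat) p q r :
    (p < q < r)%N -> (a, b) <> (0, 0) ->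
    (forall t, t \in [:: p; q; r] -> a * t%:R + b * (Y t)%:R = c) ->
  balanced (r - q) (q - p) p q r Y.
Proof.
move=> pqr ab line.
have lp : a * p%:R + b * (Y p)%:R = c by apply: line; rewrite !inE eqxx.
have lq : a * q%:R + b * (Y q)%:R = c by apply: line; rewrite !inE eqxx orbT.
have lr : a * r%:R + b * (Y r)%:R = c by apply: line; rewrite !inE eqxx !orbT.
have b0 : b != 0.
  apply/eqP => b0; apply: ab; rewrite b0 !mul0r !addr0 in lp lq *; congr pair.
  have : a * (q%:R - p%:R) = 0 by rewrite mulrBr lp lq subrr.
  move/eqP; rewrite mulf_eq0 subr_eq0 eqr_nat => /orP[/eqP //|/eqP]; lia.
apply/eqP; rewrite -(eqr_nat R) -subr_eq0; apply/eqP.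
apply: (mulfI b0); rewrite mulr0.
rewrite !natrD !natrM !natrD !natrB; try lia.
transitivity ((r%:R - q%:R) * (a * p%:R + b * (Y p)%:R)
  + (q%:R - p%:R) * (a * r%:R + b * (Y r)%:R)
  - (r%:R - p%:R) * (a * q%:R + b * (Y q)%:R)); first by ring.
by rewrite lp lq lr; ring.
Qed.

Lemma log2_ge (R : realType) (k : nat) (x : R) : 2 ^+ k <= x -> k%:R <= log2 x.
Proof.
move=> kx; have ln2 : 0 < ln (2 : R) by rewrite ln_gt0 // ltr1n.
rewrite /log2 ler_pdivlMr // mulr_natl -lnXn ?ltr0n // ler_ln //.
- by rewrite posrE exprn_gt0.
- by rewrite posrE (lt_le_trans _ kx) // exprn_gt0.
Qed.

Theorem theorem6p1 (R : realType) :
  exists C : R, 0 < C /\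
  exists N : nat, forall n : nat, (N <= n)%N ->
  exists S : {fset int * int},
    (forall s : int * int, s \in S ->
       s.1 = 1 /\ 1 <= s.2 <= ((n + 1) ^ 3)%N%:Z) /\
    (#|` S|)%:R <= 5 / 2 * log2 (log2 (n%:R : R)) + C /\
    exists Q : seq (int * int),
      size Q = n.+1 /\ is_walk S Q /\ uniq Q /\ no_three_collinear R Q.
Proof.
exists 18%:R; split; first by rewrite ltr0n.
exists 2%N => n n2.
pose I := trunc_log 2 (trunc_log 2 n); pose m := (18 + I.*2)%N.
have wm t : (t < n)%N -> (word t < m)%N by apply: word_bound.
have [f [f_le f_gen]] := generic_heights wm.
pose letters := [seq ((1 : int), (f a)%:Z) | a <- iota 0 m].
have SE s : (s \in [fset x in letters]%fset) = (s \in letters).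
  by rewrite in_fset.
exists [fset x in letters]%fset; split; [|split].
- move=> s; rewrite SE => /mapP[a _ ->] /=; split=> //.
  by have := f_le a; rewrite addn1 !lez_nat.
- have card_le : (#|` [fset x in letters]%fset| <= m)%N.
    by rewrite card_fseq (leq_trans (size_undup _)) // size_map size_iota.
  have I_le : I%:R <= log2 (log2 (n%:R : R)).
    apply: log2_ge; rewrite -natrX.
    have tl : (2 ^ I <= trunc_log 2 n)%N.
      by apply: trunc_logP => //; rewrite trunc_log_gt0.
    apply: le_trans (log2_ge (k := trunc_log 2 n) _); first by rewrite ler_nat.
    by rewrite -natrX ler_nat; apply: trunc_logP => //; lia.
  have I_ge0 : 0 <= I%:R :> R by rewrite ler0n.
  have : (#|` [fset x in letters]%fset|)%:R <= m%:R :> R by rewrite ler_nat.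
  by rewrite /m natrD -muln2 natrM; lra.
pose vertex t : int * int := (t%:Z, (height f t)%:Z).
have vertex_inj : injective vertex by move=> s t [].
exists (map vertex (iota 0 n.+1)); split; first by rewrite size_map size_iota.
split; [|split].
- apply/(sortedP (0, 0)) => i; rewrite size_map size_iota => i_lt.
  rewrite !(nth_map 0%N) ?size_iota ?nth_iota //; try lia.
  rewrite /= SE; apply/mapP; exists (word (0 + i)).
    by rewrite mem_iota /=; apply: wm; lia.
  rewrite /vertex /height !add0n big_nat_recr //=; congr (_, _) => /=; lia.
- by rewrite map_inj_uniq ?iota_uniq.
have no_line a b c p q r : (p < q < r)%N -> (r <= n)%N ->
    (a, b) <> ((0 : R), (0 : R)) ->
    ~ forall u, u \in [:: vertex p; vertex q; vertex r] ->
        a * u.1%:~R + b * u.2%:~R = c.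
  move=> pqr rn ab line; apply: (f_gen p q r pqr rn).
  apply: (line_balanced (c := c) pqr ab) => t tin.
  apply: (line (vertex t)).
  by rewrite -[_ :: _]/(map vertex [:: p; q; r]) map_f.
move=> _ _ _ /mapP[i + ->] /mapP[j + ->] /mapP[k + ->].
rewrite !mem_iota !(inj_eq vertex_inj) => i_le j_le k_le ij ik jk.
move=> [a [b [c [ab line]]]].
have sorted_line x y z : (x < y < z)%N -> (z <= n)%N ->
    [:: vertex x; vertex y; vertex z] =i [:: vertex i; vertex j; vertex k] ->
    False.
  move=> xyz zn same; apply: (no_line a b c x y z xyz zn ab) => u.
  by rewrite same; apply: line.
case: (ltngtP i j) ij => // ij _; case: (ltngtP j k) jk => // jk _;
  case: (ltngtP i k) ik => // ik _; try lia.
- by apply: (@sorted_line i j k) => //; lia.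
- by apply: (@sorted_line i k j) => [||u]; rewrite ?inE;
    first [lia | do !case: eqP].
- by apply: (@sorted_line k i j) => [||u]; rewrite ?inE;
    first [lia | do !case: eqP].
- by apply: (@sorted_line j i k) => [||u]; rewrite ?inE;
    first [lia | do !case: eqP].
- by apply: (@sorted_line j k i) => [||u]; rewrite ?inE;
    first [lia | do !case: eqP].
- by apply: (@sorted_line k j i) => [||u]; rewrite ?inE;
    first [lia | do !case: eqP].
Qed.
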